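(* Let $G$ be a graph of order $n$ and $\overline{G}$ its complement. Then $$\eta_k(G)+\eta_k(\overline{G})\geq \binom{n}{k}\quad\text{for all } k>1,$$ and in particular $$\eta(G)+\eta(\overline{G})\geq 2^n+n-1.$$ Equality holds in the latter inequality if and only if $G$ or $\overline{G}$ has no induced path of length at least $3$.
   Context: All graphs are finite, simple and undirected. $\overline{G}$ has the same vertex set as $G$, and $uv\in E(\overline{G})$ iff $uv\notin E(G)$ (for $u\neq v$). $\eta(G)$ denotes the number of nonempty vertex subsets $S\subseteq V(G)$ such that the induced subgraph $\langle S\rangle_G$ is connected (the number of nonempty connected induced subgraphs), and $\eta_k(G)$ the number of such subsets with $|S|=k$. The length of a path is its number of edges. *)

(* Defs.v *)
From mathcomp Require Import all_boot.

Set Implicit Arguments.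
Unset Strict Implicit.
Unset Printing Implicit Defensive.

(* MathComp.  A simple graph on the vertex set T is given by its adjacency    *)
(* relation e : rel T, assumed symmetric and irreflexive where it is used.    *)

Section Graphs.

Variable T : finType.
Implicit Types (e : rel T) (S : {set T}).

Definition gcompl e : rel T := [rel u v | (u != v) && ~~ e u v].

Definition induced e S : rel T := [rel u v | [&& u \in S, v \in S & e u v]].

(* The empty set satisfies this vacuously; eta and eta_k exclude it.          *)
Definition induced_connected e S : bool :=
  [forall u in S, forall v in S, connect (induced e S) u v].

Definition eta e : nat :=
  #|[set S : {set T} | (S != set0) && induced_connected e S]|.

Definition eta_k e (k : nat) : nat :=
  #|[set S : {set T} | [&& S != set0, induced_connected e S & #|S| == k]]|.

(* An induced path with m edges, hence m.+1 vertices f 0, ..., f m.           *)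
Definition induced_path e (m : nat) (f : 'I_m.+1 -> T) : Prop :=
  injective f /\
  forall i j : 'I_m.+1, e (f i) (f j) = (j == i.+1 :> nat) || (i == j.+1 :> nat).

Definition no_long_induced_path e : Prop :=
  forall (m : nat) (f : 'I_m.+1 -> T), 3 <= m -> ~ induced_path e f.

End Graphs.

(* Main.v *)
Require Import Defs.
From mathcomp Require Import all_boot.

(** Every vertex set is connected in G or in its complement, and singletons are
    connected in both, so each inequality is inclusion-exclusion.  Equality in
    the second one says that no S with at least two vertices is connected in
    both graphs.  By Seinsche's theorem such an S contains an induced path on
    four vertices, and the vertex set of such a path is itself connected in
    both graphs, because the path is self-complementary. *)

Section ConnectedSets.

Set Implicit Arguments.
Unset Strict Implicit.

Variable T : finType.
Implicit Types (e r : rel T) (S : {set T}) (x y z u v w : T).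

Lemma gcomplE e u v : gcompl e u v = (u != v) && ~~ e u v.
Proof. by []. Qed.

Lemma inducedE e S u v : induced e S u v = [&& u \in S, v \in S & e u v].
Proof. by []. Qed.

Lemma gcompl_sym e : symmetric e -> symmetric (gcompl e).
Proof. by move=> e_sym u v; rewrite !gcomplE e_sym eq_sym. Qed.

Lemma gcompl_irr e : irreflexive (gcompl e).
Proof. by move=> u; rewrite gcomplE eqxx. Qed.

Lemma induced_connect_sym e S : symmetric e -> connect_sym (induced e S).
Proof.
by move=> e_sym; apply: sym_connect_sym => u v; rewrite !inducedE e_sym andbCA.
Qed.

Lemma induced_connectedP e S :
  reflect {in S &, forall u v, connect (induced e S) u v}
          (induced_connected e S).
Proof.
apply: (iffP forall_inP) => [cS u v uS vS | cS u uS].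
  exact: (forall_inP (cS u uS)).
by apply/forall_inP => v vS; apply: cS.
Qed.

Lemma induced_connected_hub e S c : symmetric e ->
  {in S, forall u, connect (induced e S) c u} -> induced_connected e S.
Proof.
move=> e_sym cS; apply/induced_connectedP => u v uS vS.
by apply: connect_trans (cS v vS); rewrite induced_connect_sym // cS.
Qed.

(** The last edge of a nontrivial path ends in [S]; the trivial path, which [connect] allows at any
    vertex, is where [x \in S] matters. *)
Lemma connect_induced_mem e S x y :
  connect (induced e S) x y -> x \in S -> y \in S.
Proof.
case/connectP => p; case/lastP: p => [_ -> //|p z].
by rewrite rcons_path last_rcons => /andP[_ /and3P[_ zS _]] ->.
Qed.

Lemma induced_disconnectedP e S : ~~ induced_connected e S ->
  exists u v, [/\ u \in S, v \in S & ~~ connect (induced e S) u v].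
Proof.
rewrite negb_forall_in => /exists_inP[u uS].
by rewrite negb_forall_in => /exists_inP[v vS nuv]; exists u, v.
Qed.

Lemma induced_disconnected_from e S w : symmetric e -> ~~ induced_connected e S ->
  exists2 d, d \in S & ~~ connect (induced e S) w d.
Proof.
move=> e_sym /induced_disconnectedP[a [b [aS bS nab]]].
have [wa | nwa] := boolP (connect (induced e S) w a); last by exists a.
exists b => //; apply: contra nab; apply: connect_trans.
by rewrite induced_connect_sym.
Qed.

Lemma induced_connected1 e x : induced_connected e [set x].
Proof. by apply/induced_connectedP => u v /set1P-> /set1P->. Qed.

(** If [S] splits in [e], vertices in different components are adjacent in the complement, and two
    vertices of one component have a common complement neighbour in another. *)
Lemma induced_connected_or_gcompl e S : symmetric e ->
  induced_connected e S || induced_connected (gcompl e) S.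
Proof.
move=> e_sym; case: (boolP (induced_connected e S)) => //= nS.
have far u v : u \in S -> v \in S -> ~~ connect (induced e S) u v ->
    connect (induced (gcompl e) S) u v.
  move=> uS vS nuv; apply: connect1; rewrite inducedE uS vS gcomplE /=; apply/andP; split.
    by apply: contra nuv => /eqP->; apply: connect0.
  by apply: contra nuv => euv; apply: connect1; rewrite inducedE uS vS.
apply/induced_connectedP => u v uS vS.
have [uv | ] := boolP (connect (induced e S) u v); last exact: far.
have [d dS nud] := induced_disconnected_from u e_sym nS.
apply: (connect_trans (far u d uS dS nud)); apply: far => //.
rewrite induced_connect_sym //; apply: contra nud; exact: connect_trans.
Qed.

(** Some step of the path is the first to leave [P]. Reachability of [u] from [x] is recorded so
    that the edge found can be placed in a given component. *)
Lemma connect_crossing r (P : pred T) x y : connect r x y -> P x -> ~~ P y ->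
  exists u v, [/\ connect r x u, r u v, P u & ~~ P v].
Proof.
case/connectP => p; elim: p x => [|z p IHp] x /=; first by move=> _ -> ->.
case/andP=> rxz pz yE Px nPy.
have [Pz | nPz] := boolP (P z); last by exists x, z.
have [u [v [zu ruv Pu nPv]]] := IHp z pz yE Pz nPy.
by exists u, v; split=> //; apply: connect_trans zu; apply: connect1.
Qed.

Lemma connected_component_neighbour e S v w : induced_connected e S ->
  v \in S -> w \in S :\ v -> exists2 u, connect (induced e (S :\ v)) w u & e u v.
Proof.
move=> /induced_connectedP cS vS /setD1P[wv wS].
have nwv : ~~ connect (induced e (S :\ v)) w v.
  by apply/negP => /connect_induced_mem; rewrite !inE eqxx wv wS => /(_ isT).
have [u [z [_ + wu nwz]]] :=
  connect_crossing (P := connect (induced e (S :\ v)) w)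
    (cS w v wS vS) (connect0 _ _) nwv.
case/and3P=> uS zS euz; exists u => //.
(* The edge leaving the component of [w] must end at [v]: otherwise it survives in [S :\ v] and
   keeps [z] in that component. *)
have [<- // | zv] := eqVneq z v.
case/negP: nwz; apply: (connect_trans wu); apply: connect1.
rewrite inducedE !inE uS zS zv euz /= !andbT.
by case: eqP wu => // ->; rewrite (negPf nwv).
Qed.

End ConnectedSets.

Section FourVertexPaths.

Set Implicit Arguments.
Unset Strict Implicit.

Variable T : finType.
Implicit Types (e : rel T) (S : {set T}) (x y z u v w : T).

Definition P4 e x y v z : bool :=
  [&& e x y, e y v, e v z, ~~ e x v, ~~ e x z & ~~ e y z].

(** Identifying two vertices would create a loop or make an edge coincide with a non-edge. *)
Lemma P4_uniq e x y v z : symmetric e -> irreflexive e ->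
  P4 e x y v z -> uniq [:: x; y; v; z].
Proof.
move=> e_sym e_irr /and5P[xy yv vz xv /andP[xz yz]].
rewrite /= !inE !negb_or !andbT -!andbA; apply/and5P; split; last (apply/andP; split).
- by apply: contraTneq xy => ->; rewrite e_irr.
- by apply: contraNneq xz => ->.
- by apply: contraNneq xv => ->; rewrite e_sym.
- by apply: contraTneq yv => ->; rewrite e_irr.
- by apply: contraNneq xz => <-.
- by apply: contraTneq vz => ->; rewrite e_irr.
Qed.

(** The three non-edges of the path x-y-v-z form the path y-z-x-v. *)
Lemma P4_gcompl e x y v z : symmetric e -> uniq [:: x; y; v; z] ->
  P4 (gcompl e) y z x v = P4 e x y v z.
Proof.
move=> e_sym; rewrite /= !inE !negb_or /P4 !gcomplE.
case/and4P=> /and3P[xy xv xz] /andP[yv yz] vz _.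
rewrite (eq_sym z x) (eq_sym y x) (eq_sym z v) xy xv xz yv yz vz /=.
rewrite (e_sym z x) (e_sym y x) (e_sym z v) !negbK.
by case: (e x y) (e x v) (e x z) (e y v) (e y z) (e v z) => [] [] [] [] [] [].
Qed.

Lemma P4_to_gcompl e x y v z : symmetric e -> irreflexive e ->
  P4 e x y v z -> P4 (gcompl e) y z x v.
Proof.
by move=> e_sym e_irr p; rewrite P4_gcompl // (P4_uniq e_sym).
Qed.

(** Distinctness is read off in the complement, which is irreflexive by construction. *)
Lemma P4_of_gcompl e x y v z : symmetric e ->
  P4 (gcompl e) y z x v -> P4 e x y v z.
Proof.
move=> e_sym p; rewrite -P4_gcompl //.
have := P4_uniq (gcompl_sym e_sym) (gcompl_irr e) p.
have /perm_uniq -> // : perm_eq [:: y; z; x; v] [:: x; y; v; z].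
by apply/permP => a /=; lazy; case: (a x) (a y) (a z) (a v) => [] [] [] [].
Qed.

Lemma P4_connected e x y v z : symmetric e ->
  P4 e x y v z -> induced_connected e [set x; y; v; z].
Proof.
move=> e_sym /and5P[xy yv vz _ _]; apply: (induced_connected_hub (c := y)) => //.
have cyv : connect (induced e [set x; y; v; z]) y v.
  by apply: connect1; rewrite inducedE !inE !eqxx yv !orbT.
move=> u; rewrite !inE -!orbA => /or4P[]/eqP-> //.
  by apply: connect1; rewrite inducedE !inE !eqxx e_sym xy !orbT.
by apply: connect_trans cyv _; apply: connect1; rewrite inducedE !inE !eqxx vz !orbT.
Qed.

Lemma P4_induced_path e x y v z : symmetric e -> irreflexive e ->
  P4 e x y v z -> induced_path e (m := 3) (tnth [tuple x; y; v; z]).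
Proof.
move=> e_sym e_irr p; have /tuple_uniqP inj_p := P4_uniq e_sym e_irr p.
split=> //.
case/and5P: p => xy yv vz /negPf xv /andP[/negPf xz /negPf yz].
move=> [[|[|[|[|//]]]] i4] [[|[|[|[|//]]]] j4]; rewrite !(tnth_nth x) /= ?e_irr //;
  by [| rewrite e_sym].
Qed.

Lemma induced_path_P4 e m (f : 'I_m.+1 -> T) : 3 <= m -> induced_path e f ->
  P4 e (f (inord 0)) (f (inord 1)) (f (inord 2)) (f (inord 3)).
Proof.
move=> m3 [_ ef]; have m2 := ltnW m3; have m1 := ltnW m2.
by rewrite /P4 !ef !inordK.
Qed.

(** The first four vertices of a longer induced path already form a [P4]. *)
Lemma no_long_induced_pathP e : symmetric e -> irreflexive e ->
  no_long_induced_path e <-> forall x y v z, ~~ P4 e x y v z.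
Proof.
move=> e_sym e_irr; split=> [nolong x y v z | noP4 m f m3 /(induced_path_P4 m3)].
  by apply/negP => /(P4_induced_path e_sym e_irr); apply: nolong.
exact/negP.
Qed.

(* x y is an edge of the component of w in S - v along which adjacency to v
   changes, and z is a neighbour of v in another component. *)
Lemma cut_vertex_P4 e S v w : symmetric e -> induced_connected e S ->
  v \in S -> ~~ induced_connected e (S :\ v) ->
  w \in S :\ v -> ~~ e w v -> exists x y z, P4 e x y v z.
Proof.
move=> e_sym cS vS ncSv wSv nwv.
have [u cwu uv] := connected_component_neighbour cS vS wSv.
have [d dSv nwd] := induced_disconnected_from w e_sym ncSv.
have [z cdz zv] := connected_component_neighbour cS vS dSv.
have nnuv : ~~ ~~ e u v by rewrite negbK.
have [x [y [cwx rxy nxv /negPn yv]]] :=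
  connect_crossing (P := fun a => ~~ e a v) cwu nwv nnuv.
have cwy := connect_trans cwx (connect1 rxy).
have [xSv ySv xy] := and3P rxy.
have zSv := connect_induced_mem cdz dSv.
(* [z] lies in the component of [d], so an edge from [a] to [z] would join [w] to [d]. *)
have far a : connect (induced e (S :\ v)) w a -> a \in S :\ v -> ~~ e a z.
  move=> cwa aSv; apply: contra nwd => az.
  have raz : induced e (S :\ v) a z by rewrite inducedE aSv zSv.
  apply: connect_trans (connect_trans cwa (connect1 raz)) _.
  by rewrite induced_connect_sym.
by exists x, y, z; rewrite /P4 xy yv e_sym zv nxv !far.
Qed.

(** Induction on the size of [S], deleting a vertex [v]. If [v] is a cut vertex of one graph, its
    neighbour in the other graph is the non-neighbour that [cut_vertex_P4] requires. *)
Lemma connected_both_P4 e S : symmetric e -> irreflexive e -> 1 < #|S| ->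
  induced_connected e S -> induced_connected (gcompl e) S ->
  exists x y v z, P4 e x y v z.
Proof.
move=> e_sym e_irr; have [k] := ubnP #|S|; elim: k S => // k IHk S leSk S_gt1 cS cS'.
have /card_gt0P[v vS] := ltnW S_gt1.
have Sv : #|S| = #|S :\ v|.+1 by rewrite (cardsD1 v) vS.
have /card_gt0P[a aSv] : 0 < #|S :\ v| by rewrite Sv in S_gt1.
have [w cw ewv] := connected_component_neighbour cS vS aSv.
have [w' cw' ewv'] := connected_component_neighbour cS' vS aSv.
have wSv := connect_induced_mem cw aSv; have wSv' := connect_induced_mem cw' aSv.
have [cSv | ncSv] := boolP (induced_connected e (S :\ v)); last first.
  have /andP[_ nwv'] := ewv'.
  by have [x [y [z p]]] := cut_vertex_P4 e_sym cS vS ncSv wSv' nwv'; exists x, y, v, z.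
have [cSv' | ncSv'] := boolP (induced_connected (gcompl e) (S :\ v)); last first.
  have nwv : ~~ gcompl e w v by rewrite gcomplE ewv andbF.
  have [x [y [z p]]] := cut_vertex_P4 (gcompl_sym e_sym) cS' vS ncSv' wSv nwv.
  by exists v, x, z, y; apply: P4_of_gcompl.
apply: (IHk (S :\ v)) => //; first by rewrite -ltnS -Sv.
(* [w] and [w'] differ, being joined to [v] in opposite graphs, so [S :\ v] still has two
   vertices. *)
rewrite (cardsD1 w) wSv ltnS card_gt0; apply/set0Pn; exists w'.
rewrite in_setD1 wSv' andbT; apply: contraTneq ewv' => ->.
by rewrite gcomplE ewv andbF.
Qed.

End FourVertexPaths.

Theorem theorem2 (n : nat) (T : finType) (e : rel T)
    (e_sym : symmetric e) (e_irr : irreflexive e) (order_n : #|T| = n) :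
  [/\ forall k : nat, 1 < k -> 'C(n, k) <= eta_k e k + eta_k (gcompl e) k,
      2 ^ n + n - 1 <= eta e + eta (gcompl e)
    & eta e + eta (gcompl e) = 2 ^ n + n - 1 <->
      no_long_induced_path e \/ no_long_induced_path (gcompl e)].
Proof.
have e_sym' := gcompl_sym e_sym; have e_irr' := gcompl_irr e.
have cor S := induced_connected_or_gcompl S e_sym.
pose both := [set S : {set T} |
  [&& S != set0, induced_connected e S & induced_connected (gcompl e) S]].
pose ones := [set [set x] | x in T].
have ones_n : #|ones| = n.
  by rewrite card_imset ?order_n // => x y; apply: set1_inj.
have sub : ones \subset both.
  apply/subsetP => _ /imsetP[x _ ->].
  by rewrite inE -card_gt0 cards1 !induced_connected1.
(* By [cor] the union of the two families is all nonempty sets; their intersection is [both]. *)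
have etaE : eta e + eta (gcompl e) = 2 ^ n - 1 + #|both|.
  rewrite /eta -cardsUI; congr (_ + _); last first.
    by apply: eq_card => S; rewrite !inE; case: (S != set0).
  transitivity #|[set~ (set0 : {set T})]|.
    by apply: eq_card => S; rewrite !inE -andb_orr cor andbT.
  by rewrite cardsC1 -cardsT -powersetT card_powerset cardsT order_n subn1.
have boundE : 2 ^ n + n - 1 = 2 ^ n - 1 + n by rewrite addnBAC ?expn_gt0.
split=> [k k_gt1||].
- rewrite /eta_k -cardsUI -order_n -(card_draws T k).
  apply: leq_trans (leq_addr _ _); apply: subset_leq_card.
  apply/subsetP => S; rewrite !inE => /eqP Sk.
  by rewrite -card_gt0 Sk eqxx !andbT (ltnW k_gt1) /= cor.
- by rewrite etaE boundE leq_add2l -ones_n subset_leq_card.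
rewrite etaE boundE; split=> [/addnI both_n | noP4].
  left; apply/no_long_induced_pathP => // x y v z; apply/negP => p.
  pose S := [set x; y; v; z].
  (* The complementary path visits the same vertices in another order. *)
  have SE : [set y; z; x; v] = S.
    by apply/setP=> u; rewrite !inE; do 4!case: (u == _).
  have both_ones : ones = both.
    by apply/eqP; rewrite eqEcard sub both_n ones_n /=.
  have : S \in ones.
    rewrite both_ones inE (P4_connected e_sym p) /=.
    rewrite -{2}SE (P4_connected e_sym' (P4_to_gcompl e_sym e_irr p)).
    by rewrite andbT; apply/set0Pn; exists x; rewrite !inE eqxx.
  (* A singleton would force [x = y], against the edge between them. *)
  case/imsetP => t _ St.
  have : x \in S by rewrite !inE eqxx.
  have : y \in S by rewrite !inE eqxx orbT.
  rewrite St !inE => /eqP yt /eqP xt.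
  by case/and3P: p; rewrite yt xt e_irr.
suff -> : both = ones by rewrite ones_n.
apply/eqP; rewrite eqEsubset sub andbT; apply/subsetP => S.
rewrite inE => /and3P[S0 cS cS'].
have [S_gt1 | ] := ltnP 1 #|S|; last first.
  move=> S_le1; have /cards1P[x ->] : #|S| == 1 by rewrite eqn_leq S_le1 card_gt0.
  exact: imset_f.
have [x [y [v [z p]]]] := connected_both_P4 e_sym e_irr S_gt1 cS cS'.
(* Whichever graph is assumed free of long induced paths, the [P4] found in [e] contradicts it,
   directly or after complementation. *)
case: noP4 => /no_long_induced_pathP noP4.
  by have := noP4 e_sym e_irr x y v z; rewrite p.
by have := noP4 e_sym' e_irr' y z x v; rewrite P4_to_gcompl.
Qed.
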